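(* Given an interval graph $G$ with claw number $\psi(G)$ and independence number $\alpha$, $$\lceil \log_2 \psi(G)\rceil \le \mathrm{cub}(G)\le \min\left(\lceil \log_2\psi(G)\rceil+2,\ \lceil \log_2\alpha\rceil\right).$$
   Context: Graphs are simple and undirected. A graph is an interval graph if and only if its vertices can be mapped to intervals on the real line such that two vertices are adjacent if and only if their corresponding intervals overlap (intersect). A $b$-dimensional cube is a Cartesian product $I_1\times I_2\times\cdots\times I_b$, where each $I_i$ is a closed interval of unit length on the real line. The cubicity $\mathrm{cub}(G)$ of a graph $G$ is the minimum positive integer $b$ such that the vertices of $G$ can be mapped to axis-parallel $b$-dimensional cubes in such a way that two vertices are adjacent in $G$ if and only if their assigned cubes intersect. $S(m)$ denotes the star graph on $m+1$ vertices, i.e. the complete bipartite graph $K_{1,m}$. The claw number $\psi(G)$ of a graph $G$ is the largest positive integer $m$ such that $S(m)$ is an induced subgraph of $G$. The independence number $\alpha$ of $G$ is the maximum size of an independent set of vertices of $G$.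
   Formalization: For complete graphs (α ≤ 1) the bound cub(G) ≤ ⌈log₂ α⌉ is dropped, as it fails there (K₂ has cub = 1, ⌈log₂ 1⌉ = 0); the other bounds are kept. For edgeless G, ψ(G) and ⌈log₂ ψ(G)⌉ are taken as 0. *)

(* Defs.v *)
(* Libraries: MathComp and MathComp-Analysis. *)
From mathcomp Require Import all_boot all_order all_algebra.
From mathcomp Require Import boolp classical_sets reals.
From mathcomp Require Import topology normedtype.
From mathcomp Require Import lra.

Set Implicit Arguments.
Unset Strict Implicit.
Unset Printing Implicit Defensive.

Import Order.TTheory GRing.Theory Num.Theory.

Local Open Scope classical_set_scope.
Local Open Scope ring_scope.

Record sgraph := SGraph {
  vertex :> finType;
  adj : rel vertex;
  adj_sym : symmetric adj;
  adj_irrefl : irreflexive adj }.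

Arguments adj {s} x y.

Definition bip_adj (p q : nat) : rel ('I_p + 'I_q) := fun x y =>
  match x, y with
  | inl _, inr _ | inr _, inl _ => true
  | _, _ => false
  end.

Lemma bip_adj_sym p q : symmetric (@bip_adj p q).
Proof. by move=> [x|x] [y|y]. Qed.

Lemma bip_adj_irrefl p q : irreflexive (@bip_adj p q).
Proof. by move=> [x|x]. Qed.

Definition complete_bipartite (p q : nat) : sgraph :=
  SGraph (@bip_adj_sym p q) (@bip_adj_irrefl p q).

Definition star (m : nat) : sgraph := complete_bipartite 1 m.

Definition induced_subgraph (H G : sgraph) : bool :=
  [exists f : {ffun H -> G},
    injectiveb f && [forall x, forall y, adj (f x) (f y) == adj x y]].

(* The bound m < #|G| loses nothing, since star m has m + 1 vertices.  The    *)
(* value is 0 exactly when no positive m qualifies, i.e. G has no edge.       *)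
Definition claw_number (G : sgraph) : nat :=
  \max_(m < #|G| | (0 < m)%N && induced_subgraph (star m) G) m.

Definition independent (G : sgraph) (A : {set G}) : bool :=
  [forall x in A, forall y in A, ~~ adj x y].

Definition independence_number (G : sgraph) : nat :=
  \max_(A : {set G} | independent A) #|A|.

Section Representations.
Variable R : realType.

Definition interval_graph (G : sgraph) : Prop :=
  exists I : G -> set R,
    (forall v, is_interval (I v) /\ I v !=set0) /\
    (forall u v, u != v -> (adj u v <-> I u `&` I v !=set0)).

Definition unit_cube (b : nat) (a : 'rV[R]_b) : set 'rV[R]_b :=
  [set p | forall i, p ord0 i \in `[a ord0 i, a ord0 i + 1]].

Definition cube_representable (G : sgraph) (b : nat) : Prop :=
  exists c : G -> 'rV[R]_b,
    forall u v, u != v ->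
      (adj u v <-> unit_cube (c u) `&` unit_cube (c v) !=set0).

(* One coordinate per vertex w: w is placed at 0, its neighbours at 1 and     *)
(* every other vertex at 2.  The extra dimension covers the empty graph.      *)
Lemma cubicity_exists (G : sgraph) :
  exists b, (0 < b)%N && `[< cube_representable G b >].
Proof.
exists #|G|.+1; apply/asboolP.
pose h (w v : G) : R := if v == w then 0 else if adj w v then 1 else 2.
pose d (i : 'I_#|G|.+1) (v : G) : R :=
  if unlift ord_max i is Some j then h (enum_val j) v else 0.
have hE w v : h w v = 0 \/ h w v = 1 \/ h w v = 2.
  by rewrite /h; case: ifP => _; [left|case: ifP => _; right; [left|right]].
exists (fun v => \row_i d i v) => u v neq_uv; split=> [uv|[p [pu pv]]].
  exists (\row_i Num.max (d i u) (d i v)).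
  have key i : d i u <= d i v + 1 /\ d i v <= d i u + 1.
    rewrite /d; case: unliftP => [j _|_]; last by split; lra.
    set w := enum_val j; rewrite /h.
    have [eq_uw|_] := eqVneq u w; have [eq_vw|_] := eqVneq v w.
    - by split; lra.
    - by rewrite -eq_uw uv; split; lra.
    - by rewrite -eq_vw adj_sym uv; split; lra.
    - by case: (adj w u); case: (adj w v); split; lra.
  by split=> i; rewrite !mxE in_itv /= ge_max le_max lexx ?orbT /=;
    have [ku kv] := key i; rewrite ?ku ?kv ?andbT //; lra.
apply/negPn/negP => /negbTE nuv.
have := pu (lift ord_max (enum_rank u)); have := pv (lift ord_max (enum_rank u)).
rewrite !mxE !in_itv /= /d liftK enum_rankK /h eqxx eq_sym (negbTE neq_uv) nuv.
by move=> /andP[? ?] /andP[? ?]; lra.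
Qed.

Definition cubicity (G : sgraph) : nat := ex_minn (cubicity_exists G).

End Representations.

(* Main.v *)
(* Lower bound: the cube of the centre of a star has 2 ^ b corners, each leaf *)
(* cube contains one of them, and disjoint leaf cubes contain distinct ones.  *)
(*                                                                            *)
(* Upper bounds: let level v be the largest size of an independent set lying  *)
(* entirely to the left of v.  It increases strictly from left to right along *)
(* disjoint intervals, is less than the independence number, and adjacent     *)
(* vertices have levels that differ by less than the claw number.  Cut the    *)
(* vertices into blocks 0, 1, 2, ... and place blocks 2j and 2j+1 at distance *)
(* one, shifting the former by right endpoints and the latter by left         *)
(* endpoints (both scaled into [0, 1)): if adjacent vertices lie in the same  *)
(* or in consecutive blocks this is a coordinate of a cube representation,    *)
(* and it separates the disjoint intervals in blocks 2j and 2j+1, as well as  *)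
(* those in non-consecutive blocks.  If u is left of v, then some bit of      *)
(* level is 0 at u and 1 at v; taking each bit as a two-block partition gives *)
(* the bound by the independence number.  With 2 ^ k at least the claw        *)
(* number, the k low bits separate vertices having the same value of          *)
(* level / 2 ^ k, and the blocks level / 2 ^ k and level / 2 ^ k + 1 (the     *)
(* shift exchanges even and odd blocks) separate all the others.              *)

Require Import Defs.
From mathcomp Require Import all_boot all_order all_algebra.
From mathcomp Require Import boolp reals zify lra.
From mathcomp Require classical_sets.

Set Implicit Arguments.
Unset Strict Implicit.
Unset Printing Implicit Defensive.

Import Order.TTheory GRing.Theory Num.Theory.

(** The lower bound rests on [star_cube_bound]. Both upper bounds apply [cube_representable_blocks]
    to functions that change by at most one along an edge; [level_lt] and [carry_bit] give the
    separation, and [level_adj] brings in the claw number. *)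

Lemma carry_bit k a b : a < b -> a %/ 2 ^ k = b %/ 2 ^ k ->
  exists i : 'I_k, ~~ odd (a %/ 2 ^ i) && odd (b %/ 2 ^ i).
Proof.
elim: k => [|k IHk] lt_ab; first by rewrite expn0 !divn1; lia.
rewrite expnSr !divnMA => eq_half.
have le_ab : a %/ 2 ^ k <= b %/ 2 ^ k by apply: leq_div2r; lia.
have [/(IHk lt_ab)[i ab_i]|neq_ab] := eqVneq (a %/ 2 ^ k) (b %/ 2 ^ k).
  by exists (widen_ord (leqnSn k) i).
(* The quotients differ but have the same half, so the smaller is even and the larger is odd. *)
by exists ord_max => /=; lia.
Qed.

(** * Cubes and the corner argument *)

Section Cubes.
Import classical_sets.
Variable R : realType.
Local Open Scope classical_set_scope.
Local Open Scope ring_scope.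

Lemma unit_cube_meetP b (x y : 'rV[R]_b) :
  unit_cube x `&` unit_cube y !=set0 <->
  forall i, x ord0 i <= y ord0 i + 1 /\ y ord0 i <= x ord0 i + 1.
Proof.
split=> [[p [px py]] i|near].
  by have := px i; have := py i; rewrite !in_itv /=; lra.
exists (\row_i Num.max (x ord0 i) (y ord0 i)).
by split=> i; have [xy yx] := near i;
  rewrite mxE in_itv /= le_max ge_max lexx ?orbT /=; apply/andP; split=> //; lra.
Qed.

Lemma cube_representable_nat (G : sgraph) b (M : nat) (F : 'I_b -> G -> nat) :
  (0 < M)%N ->
  (forall u v, u != v ->
     adj u v = [forall i, (F i u <= F i v + M)%N && (F i v <= F i u + M)%N]) ->
  cube_representable R G b.
Proof.
move=> M_gt0 adjE; exists (fun v => \row_i ((F i v)%:R / M%:R)) => u v neq_uv.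
have le_scaled m n : (m%:R / M%:R <= n%:R / M%:R + 1 :> R) = (m <= n + M)%N.
  have M_neq0 : M%:R != 0 :> R by rewrite pnatr_eq0 -lt0n.
  rewrite -[X in _ + X](divff M_neq0) -mulrDl -natrD ler_pM2r ?ler_nat //.
  by rewrite invr_gt0 ltr0n.
rewrite adjE // unit_cube_meetP; split=> [/forallP near i|near].
  by rewrite !mxE !le_scaled; apply/andP/near.
by apply/forallP => i; have [] := near i; rewrite !mxE !le_scaled => -> ->.
Qed.

Lemma star_cube_bound (G : sgraph) m b :
  induced_subgraph (star m) G -> cube_representable R G b -> (m <= 2 ^ b)%N.
Proof.
case/existsP=> f /andP[/injectiveP f_inj /forallP fP] [c cP].
have fE x y : adj (f x) (f y) = adj x y by apply/eqP; have /forallP := fP x; exact.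
pose a := c (f (inl ord0)); pose l j := c (f (inr j)).
(* This names a corner of the centre cube lying in leaf cube [j]: the upper end of side [i] where
   the value is true, the lower end elsewhere. *)
pose sign (j : 'I_m) := [ffun i : 'I_b => a ord0 i <= l j ord0 i].
have near_a j i : a ord0 i <= l j ord0 i + 1 /\ l j ord0 i <= a ord0 i + 1.
  apply: (unit_cube_meetP a (l j)).1; apply/cP; last by rewrite fE.
  by apply/eqP => /f_inj.
suff sign_inj : injective sign.
  have := leq_card sign sign_inj.
  by rewrite card_ord card_ffun card_bool card_ord.
move=> j j' eq_sign; apply/eqP/negPn/negP => neq_j.
have neq_f : f (inr j) != f (inr j') by apply/eqP => /f_inj[] /eqP; apply/negP.
suff /(cP _ _ neq_f) : unit_cube (l j) `&` unit_cube (l j') !=set0 by rewrite fE.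
apply/unit_cube_meetP => i; have := congr1 (fun s : {ffun _ -> bool} => s i) eq_sign.
have [] := near_a j i; have [] := near_a j' i; rewrite !ffunE.
by do 2!case: lerP => ? //; lra.
Qed.

End Cubes.

(* The second clause says that the order is (2+2)-free; with irreflexivity it *)
(* implies transitivity.                                                      *)
Definition interval_order (G : sgraph) (prec : rel G) : Prop :=
  [/\ irreflexive prec,
      forall a b c d, prec a b -> prec c d -> prec a d || prec c b &
      forall u v, adj u v = [&& u != v, ~~ prec u v & ~~ prec v u]].

(** The intervals need not be closed or bounded, so they are compared pointwise instead of by
    endpoints. *)
Lemma interval_graph_order (R : realType) (G : sgraph) :
  interval_graph R G -> exists prec : rel G, interval_order prec.
Proof.
case=> I [I_itv adjP].
pose prec u v := `[< forall x y, I u x -> I v y -> (x < y)%R >].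
have precN u v : ~~ prec u v -> exists x y, [/\ I u x, I v y & (y <= x)%R].
  move/asboolPn => nuv; apply: contrapT => none; apply: nuv => x y ux vy.
  by rewrite ltNge; apply/negP => le_yx; apply: none; exists x, y.
exists prec; split=> [v|a b c d /asboolP ab /asboolP cd|u v].
- have [_ [x vx]] := I_itv v.
  by apply/negP => /asboolP/(_ x x vx vx); rewrite ltxx.
- apply/norP => -[/precN[x [y [ax dy le_yx]]] /precN[p [q [cp bq le_qp]]]].
  have := ab x q ax bq; have := cd p y cp dy => lt_py lt_xq.
  by have := lt_le_trans (lt_trans (lt_le_trans lt_py le_yx) lt_xq) le_qp; rewrite ltxx.
have [->|neq_uv] := eqVneq u v; first by rewrite adj_irrefl.
rewrite /=; apply/idP/andP => [/(adjP _ _ neq_uv)[p [up vp]]|[/precN nuv /precN nvu]].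
  split; apply/asboolPn => /(_ p p); rewrite ltxx; first by move/(_ up vp).
  by move/(_ vp up).
apply/(adjP _ _ neq_uv).
have [[x [y [ux vy le_yx]]] [y' [x' [vy' ux' le_xy']]]] := (nuv, nvu).
(* The larger of [x'] and [y] lies in both intervals. *)
have [le_x'y|lt_yx'] := leP x' y.
  exists y; split=> //; apply: (I_itv u).1 ux' ux _ _; exact/andP.
exists x'; split=> //; apply: (I_itv v).1 vy vy' _ _.
by rewrite (ltW lt_yx').
Qed.

(** * Integer endpoints, block coordinates and levels *)

Section IntervalOrder.
Variables (G : sgraph) (prec : rel G).
Hypothesis prec_io : interval_order prec.

Lemma prec_irr : irreflexive prec.
Proof. by case: prec_io. Qed.

Lemma prec_2p2 a b c d : prec a b -> prec c d -> prec a d || prec c b.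
Proof. by case: prec_io => _ + _; apply. Qed.

Lemma adj_prec u v : adj u v = [&& u != v, ~~ prec u v & ~~ prec v u].
Proof. by case: prec_io. Qed.

Lemma prec_trans : transitive prec.
Proof. by move=> b a c ab bc; have := prec_2p2 ab bc; rewrite prec_irr orbF. Qed.

Lemma prec_nadj u v : prec u v -> ~~ adj u v.
Proof. by rewrite adj_prec => ->; rewrite andbF. Qed.

(* Down-sets are linearly ordered by inclusion, so their cardinals can serve  *)
(* as integer left endpoints.                                                 *)
Definition lend v := #|[set w | prec w v]|.
Definition rend u := \max_(x | ~~ prec u x) lend x.

(** If [u] precedes [v] but not [x], then by (2+2)-freeness all predecessors of [x] precede [v], and
    [u] makes the inclusion of down-sets strict. *)
Lemma precE u v : prec u v = (rend u < lend v).
Proof.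
apply/idP/idP => [uv|]; last first.
  by apply: contraTT; rewrite -leqNgt => nuv; exact: (leq_bigmax_cond (F := lend)) nuv.
have lt_lend x : ~~ prec u x -> lend x < lend v.
  move=> nux; apply: proper_card; apply/properP; split.
    apply/subsetP => w; rewrite !inE => wx.
    by have := prec_2p2 wx uv; rewrite (negbTE nux) orbF.
  by exists u; rewrite inE.
rewrite /rend; apply: (big_ind (fun n => n < lend v)) => // [|m n lt_m lt_n].
  by apply: leq_ltn_trans (lt_lend u _); rewrite ?prec_irr.
by rewrite gtn_max lt_m.
Qed.

Lemma lend_le_rend v : lend v <= rend v.
Proof. by rewrite leqNgt -precE prec_irr. Qed.

Lemma rend_max v : rend v < #|G|.+1.
Proof. by rewrite ltnS; apply/bigmax_leqP => x _; exact: max_card. Qed.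

(** The unit [#|G|.+1] exceeds every endpoint; [uphalf] gives blocks 2h - 1 and 2h the same multiple
    of it. *)
Definition block_coord (j : G -> nat) v :=
  #|G|.+1 * uphalf (j v) + (if odd (j v) then lend v else rend v).

Lemma block_coord_adj j u v :
  adj u v -> j v <= (j u).+1 -> block_coord j v <= block_coord j u + #|G|.+1.
Proof.
rewrite adj_prec => /and3P[_]; rewrite !precE -!leqNgt => le_vu le_uv le_j.
have := (lend_le_rend u, lend_le_rend v, rend_max u, rend_max v).
move=> [[[? ?] ?] ?]; rewrite /block_coord.
have /orP[le_h|/eqP eq_h] : (uphalf (j v) <= uphalf (j u)) ||
    (uphalf (j v) == (uphalf (j u)).+1) by lia.
  have := leq_mul (leqnn #|G|.+1) le_h.
  by case: (odd (j u)); case: (odd (j v)); lia.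
(* Here [j u] is even and [j v] is its successor, so the claim reduces to [lend v <= rend u]. *)
by rewrite eq_h mulnS; case: ifP => ?; case: ifP => ?; lia.
Qed.

(** Equivalent to [uphalf (j u) < uphalf (j v)]. *)
Definition separates (j : G -> nat) (u v : G) :=
  ((j u).+2 <= j v) || ~~ odd (j u) && (j v == (j u).+1).

Lemma block_coord_sep j u v :
  prec u v -> separates j u v -> block_coord j u + #|G|.+1 < block_coord j v.
Proof.
rewrite precE /block_coord => lt_uv sep_j.
have := (lend_le_rend u, lend_le_rend v); move=> [? ?].
have le_h : (uphalf (j u)).+1 <= uphalf (j v) by rewrite /separates in sep_j; lia.
have := leq_mul (leqnn #|G|.+1) le_h; rewrite mulnS.
by case: (odd (j u)); case: (odd (j v)); lia.
Qed.

Lemma cube_representable_blocks (R : realType) b (j : 'I_b -> G -> nat) :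
  (forall i u v, adj u v -> j i v <= (j i u).+1) ->
  (forall u v, prec u v -> exists i, separates (j i) u v) ->
  cube_representable R G b.
Proof.
move=> j_adj j_sep.
apply: (@cube_representable_nat R G b #|G|.+1 (fun i => block_coord (j i))) => //.
move=> u v neq_uv; apply/idP/forallP => [uv i|near].
  by rewrite !block_coord_adj ?j_adj // adj_sym.
rewrite adj_prec neq_uv /=; apply/andP.
by split; apply/negP => /[dup] prec_uv /j_sep[i /(block_coord_sep prec_uv)];
  have := near i; lia.
Qed.

Definition level v :=
  \max_(A : {set G} | independent A && [forall w in A, prec w v]) #|A|.

Lemma level_witness v : exists A : {set G},
  [/\ independent A, forall w, w \in A -> prec w v & #|A| = level v].
Proof.
have A0 : independent (set0 : {set G}) && [forall w in set0, prec w v].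
  by apply/andP; split; apply/forall_inP => w; rewrite inE.
rewrite /level (bigop.bigmax_eq_arg set0) //; case: arg_maxnP => // A.
by case/andP=> indA /forall_inP leA _; exists A.
Qed.

Lemma level_max v (A : {set G}) :
  independent A -> (forall w, w \in A -> prec w v) -> #|A| <= level v.
Proof.
move=> indA leA; apply: (@leq_bigmax_cond _ _ (fun B : {set G} => #|B|)).
by rewrite indA; apply/forall_inP.
Qed.

Lemma independent_setU1 v (A : {set G}) :
  independent A -> (forall w, w \in A -> prec w v) -> independent (v |: A).
Proof.
move=> /forall_inP indA leA; apply/forall_inP => x xA; apply/forall_inP => y.
move: xA; rewrite !in_setU1 => /predU1P[->|xA] /predU1P[->|yA].
- by rewrite adj_irrefl.
- by rewrite adj_sym prec_nadj ?leA.
- by rewrite prec_nadj ?leA.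
by move/forall_inP: (indA x xA); apply.
Qed.

Lemma card_setU1_prec v (A : {set G}) :
  (forall w, w \in A -> prec w v) -> #|v |: A| = #|A|.+1.
Proof.
move=> leA; rewrite cardsU1 (_ : v \notin A) //.
by apply/negP => /leA; rewrite prec_irr.
Qed.

Lemma level_lt u v : prec u v -> level u < level v.
Proof.
move=> uv; have [A [indA leA <-]] := level_witness u.
rewrite -(card_setU1_prec leA); apply: level_max => [|w].
  exact: independent_setU1.
by rewrite in_setU1 => /predU1P[->//|/leA wu]; exact: prec_trans uv.
Qed.

Lemma level_lt_independence v : level v < independence_number G.
Proof.
have [A [indA leA <-]] := level_witness v; rewrite -(card_setU1_prec leA).
apply: (@leq_bigmax_cond _ _ (fun B : {set G} => #|B|)).
exact: independent_setU1.
Qed.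

End IntervalOrder.

(** * Claws and levels *)

Lemma induced_star (G : sgraph) v (A : {set G}) :
  independent A -> (forall w, w \in A -> adj w v) ->
  induced_subgraph (star #|A|) G.
Proof.
move=> /forall_inP indA adjA.
pose f (x : star #|A|) : G := if x is inr i then enum_val i else v.
apply/existsP; exists (finfun f); apply/andP; split.
  apply/injectiveP => x y; rewrite !ffunE; case: x y => [x|x] [y|y] //=.
  - by rewrite !ord1.
  - by move=> eq_v; have := adjA _ (enum_valP y); rewrite -eq_v adj_irrefl.
  - by move=> eq_v; have := adjA _ (enum_valP x); rewrite eq_v adj_irrefl.
  - by move/enum_val_inj->.
apply/forallP => x; apply/forallP => y; rewrite !ffunE.
case: x y => [x|x] [y|y] /=; apply/eqP.
- exact: adj_irrefl.
- by rewrite adj_sym adjA ?enum_valP.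
- by rewrite adjA ?enum_valP.
by apply/negbTE; move/forall_inP: (indA _ (enum_valP x)); apply; exact: enum_valP.
Qed.

Lemma induced_star_claw (G : sgraph) m :
  0 < m -> induced_subgraph (star m) G -> m <= claw_number G.
Proof.
move=> m_gt0 star_m; have [f /andP[/injectiveP f_inj _]] := existsP star_m.
have lt_mG : m < #|G|.
  by have := leq_card f f_inj; rewrite card_sum !card_ord.
by apply: (@leq_bigmax_cond _ _ val (Ordinal lt_mG)); rewrite /= m_gt0.
Qed.

(** In a witness for [level prec u], at most [level prec v] members precede [v]; the others,
    together with [u], are the leaves of a claw centred at [v]. *)
Lemma level_adj (G : sgraph) (prec : rel G) u v :
  interval_order prec -> adj u v -> level prec u < level prec v + claw_number G.
Proof.
move=> io uv; have [A [indA leA <-]] := level_witness prec u.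
pose B := [set w in A | prec w v]; pose C := A :\: B.
have subA (D : {set G}) : D \subset A -> independent D.
  move=> /subsetP DA; apply/forall_inP => x /DA xA; apply/forall_inP => y /DA.
  by move: y; apply/forall_inP; move/forall_inP: indA; apply.
have sBA : B \subset A by apply/subsetP => w; rewrite inE => /andP[].
have le_B : #|B| <= level prec v.
  by apply: level_max (subA _ sBA) _ => w; rewrite inE => /andP[].
have leC w : w \in C -> prec w u by rewrite inE => /andP[_ /leA].
have star_C : induced_subgraph (star #|u |: C|) G.
  apply: (@induced_star _ v) => [|w].
    exact: (independent_setU1 io (subA _ (subsetDl A B)) leC).
  rewrite in_setU1 => /predU1P[->//|wC]; have wu := leC w wC.
  rewrite (adj_prec io); apply/and3P; split.
  - by apply: contraTneq wu => ->; move: uv; rewrite (adj_prec io) => /and3P[].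
  - by move: wC; rewrite !inE => /andP[+ wA]; rewrite wA.
  - apply/negP => vw; move: uv; rewrite (adj_prec io) => /and3P[_ _] /negP; apply.
    exact: (prec_trans io vw wu).
have := induced_star_claw _ star_C; rewrite (card_setU1_prec io leC) => /(_ isT).
by have := cardsID B A; rewrite (setIidPr sBA) -/C; lia.
Qed.

(** * Bounds on the cubicity *)

Lemma claw_le_cube (R : realType) (G : sgraph) b :
  cube_representable R G b -> claw_number G <= 2 ^ b.
Proof.
by move=> rep; apply/bigmax_leqP => m /andP[_ star_m]; exact: star_cube_bound rep.
Qed.

Definition bit i n : nat := odd (n %/ 2 ^ i).

Lemma cube_representable_independence (R : realType) (G : sgraph) :
  interval_graph R G ->
  cube_representable R G (up_log 2 (independence_number G)).
Proof.
case/interval_graph_order=> prec io; set k := up_log 2 _.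
apply: (@cube_representable_blocks _ _ io R k (fun i v => bit i (level prec v))).
  by move=> i u v _; apply: leq_trans (leq_b1 _) _.
have small v : level prec v %/ 2 ^ k = 0.
  apply: divn_small; apply: leq_trans (level_lt_independence io v) _.
  exact: up_logP.
move=> u v /(level_lt io) lt_uv.
have [|i /andP[even_u odd_v]] := carry_bit (k := k) lt_uv; first by rewrite !small.
by exists i; rewrite /separates /bit odd_v (negbTE even_u).
Qed.

Lemma cube_representable_claw (R : realType) (G : sgraph) :
  interval_graph R G ->
  cube_representable R G (up_log 2 (claw_number G) + 2).
Proof.
case/interval_graph_order=> prec io; set k := up_log 2 _.
pose block v := level prec v %/ 2 ^ k.
pose j (i : 'I_(k + 2)) v :=
  match split i with inl i => bit i (level prec v) | inr s => block v + s end.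
apply: (@cube_representable_blocks _ _ io R _ j).
  move=> i u v uv; rewrite /j; case: split => [i'|s].
    by apply: leq_trans (leq_b1 _) _.
  rewrite -addSn leq_add2r /block.
  have -> : (level prec u %/ 2 ^ k).+1 = (level prec u + 2 ^ k) %/ 2 ^ k.
    by rewrite divnDr ?dvdnn // divnn expn_gt0 addn1.
  apply: leq_div2r; rewrite adj_sym in uv.
  apply: leq_trans (ltnW (level_adj io uv)) _.
  by rewrite leq_add2l; exact: up_logP.
move=> u v uv; have lt_uv := level_lt io uv.
have le_b : block u <= block v by apply: leq_div2r; exact: ltnW.
have [eq_b|neq_b] := eqVneq (block u) (block v).
  have [i /andP[even_u odd_v]] := carry_bit lt_uv eq_b.
  exists (lshift 2 i); rewrite /separates /j (unsplitK (inl i)) /bit odd_v.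
  by rewrite (negbTE even_u).
(* Adding its own parity makes the block of [u] even, so every later block is separated from it. *)
exists (rshift k (inord (odd (block u)))).
rewrite /separates /j (unsplitK (inr _)) inordK ?ltnS ?leq_b1 //; lia.
Qed.

Lemma cubicity_le (R : realType) (G : sgraph) b :
  0 < b -> cube_representable R G b -> cubicity R G <= b.
Proof.
move=> b_gt0 rep; rewrite /cubicity; case: ex_minnP => m _; apply.
by rewrite b_gt0; apply/asboolP.
Qed.

Theorem theorem2 (R : realType) (G : sgraph) (hG : interval_graph R G) :
  (1 < independence_number G ->
     up_log 2 (claw_number G) <= cubicity R G
       <= minn (up_log 2 (claw_number G) + 2)
               (up_log 2 (independence_number G))) /\
  (independence_number G <= 1 ->
     up_log 2 (claw_number G) <= cubicity R G
       <= up_log 2 (claw_number G) + 2).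
Proof.
have lower : up_log 2 (claw_number G) <= cubicity R G.
  rewrite /cubicity; case: ex_minnP => b /andP[_ /asboolP rep] _.
  by apply: up_log_min => //; exact: claw_le_cube rep.
have upper : cubicity R G <= up_log 2 (claw_number G) + 2.
  by apply: cubicity_le (cube_representable_claw hG); rewrite addn2.
split=> [alpha_gt1|_]; rewrite lower //= leq_min upper /=.
(* Cubicity is at least one by definition, and [up_log 2 n] is positive only for [n > 1]. *)
by apply: cubicity_le (cube_representable_independence hG); rewrite up_log_gt0.
Qed.
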